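(* Let $\tau$ be a finite nonempty set of proposition symbols, let $1\le d\le n$ be integers, let $\overline n=(n_i)_{i\in I}$ be an $(n,d)$-admissible tuple and let $M_{\overline n}$ be the corresponding equivalence class of $\equiv_d$. If $n_i=d$ for at least two different $i\in I$, then $C(M_{\overline n})\ge \sum_{i\in I} n_i$. Otherwise, for $\pi_j$ any one of the types with the most realizing points in the models of $M_{\overline n}$, we have $C(M_{\overline n})\ge \sum_{i\in I\setminus\{j\}} n_i = n-|\pi_j|$, where $|\pi_j|$ is the number of points of type $\pi_j$ in each model of $M_{\overline n}$.
   Context: Models: a $\tau$-model with domain $W$ assigns to each $p\in\tau$ a subset of $W$ (the points where $p$ is true). $\mathcal M$ is the set of all $\tau$-models with domain $\{1,\dots,n\}$. A type over $\tau$ is a maximally consistent set of literals ($p$ or $\neg p$, $p\in\tau$); there are $t=2^{|\tau|}$ types, enumerated as $(\pi_i)_{i\in I}$, $I=\{1,\dots,t\}$. Each point of a model realizes exactly one type. Logic: propositional formulas are $\psi ::= p\mid\neg p\mid\psi\wedge\psi\mid\psi\vee\psi$ with $p\in\tau$. Formulas of $\mathrm{GMLU}$ are built from $\diamond^{\ge k}\psi$, $\blacksquare^{<k}\psi$, $\diamond^{=k}\psi$, $\blacksquare^{\ne k}\psi$ ($\psi$ propositional, $k\in\mathbb N$) by closing under $\wedge,\vee$ and under prefixing $\diamond^{\ge k},\blacksquare^{<k},\diamond^{=k},\blacksquare^{\ne k}$. Semantics at a point $w$: Boolean connectives as usual; $\diamond^{\ge k}\varphi$ (resp. $\diamond^{=k}\varphi$)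 holds iff at least (resp. exactly) $k$ points of the domain satisfy $\varphi$; $\blacksquare^{<k}\varphi$ is equivalent to $\neg\diamond^{\ge k}\neg\varphi$ and $\blacksquare^{\ne k}\varphi$ to $\neg\diamond^{=k}\neg\varphi$. Truth of a $\mathrm{GMLU}$-formula in a model does not depend on the point, so $\mathfrak M\vDash\varphi$ is well defined. $\mathrm{GMLU}_d$ is the set of formulas of counting depth at most $d$, i.e. in which every occurring $\diamond^{\ge k},\blacksquare^{<k}$ has $k\le d$ and every occurring $\diamond^{=k},\blacksquare^{\ne k}$ has $k+1\le d$. Size: literals have size $1$; $\mathrm{size}(\varphi\wedge\psi)=\mathrm{size}(\varphi\vee\psi)=\mathrm{size}(\varphi)+\mathrm{size}(\psi)+1$; $\mathrm{size}(\diamond^{\ge k}\varphi)=\mathrm{size}(\blacksquare^{<k}\varphi)=\mathrm{size}(\varphi)+k$; $\mathrm{size}(\diamond^{=k}\varphi)=\mathrm{size}(\blacksquare^{\ne k}\varphi)=\mathrm{size}(\varphi)+k+1$. A formula $\varphi$ defines $M\subseteq\mathcal M$ if for all $\mathfrak M\in\mathcal M$: $\mathfrak M\vDash\varphi\Leftrightarrow\mathfrak M\in M$. $C(M)$ is the minimum size of a $\mathrm{GMLU}_d$-formula defining $M$. Classes: $\mathfrak M\equiv_d\mathfrak N$ iff $\mathfrak M,\mathfrak N\in\mathcal M$ satisfy the same $\mathrm{GMLU}_d$-formulas. A tuple $\overline n=(n_i)_{i\in I}$ of natural numbers is $(n,d)$-admissible if $n_i\le d$ for all $i$, $\sum_i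 n_i\le n$, and either some $n_i=d$ or $\sum_i n_i=n$. $M_{\overline n}$ is the set of models in $\mathcal M$ having exactly $n_i$ points of type $\pi_i$ whenever $n_i<d$ and at least $d$ points of type $\pi_i$ whenever $n_i=d$; the map $\overline n\mapsto M_{\overline n}$ is a bijection from $(n,d)$-admissible tuples to equivalence classes of $\equiv_d$. If at most one $n_i$ equals $d$, every model in $M_{\overline n}$ has the same number of points of each type. *)

(* Defs.v *)
From HB Require Import structures.
From mathcomp Require Import all_boot.
From mathcomp Require Import boolp.

Set Implicit Arguments.
Unset Strict Implicit.
Unset Printing Implicit Defensive.

(* [(p, true)] is the literal p and [(p, false)] the literal ~p. *)
Definition literal (tau : finType) : finType := (tau * bool)%type.

Definition consistent (tau : finType) (S : {set literal tau}) : bool :=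
  [forall p : tau, ~~ (((p, true) \in S) && ((p, false) \in S))].

Definition ptype (tau : finType) : finType :=
  {S : {set literal tau} | maxset (@consistent tau) S}.

(* The domain {1, ..., n} is rendered as 'I_n. *)
Definition model (tau : finType) (n : nat) : finType := {ffun tau -> {set 'I_n}}.

Definition true_points (tau : finType) (n : nat) (A : model tau n) (p : tau) :
  {set 'I_n} := (A : {ffun tau -> {set 'I_n}}) p.

Definition lit_sat (tau : finType) (n : nat) (A : model tau n) (w : 'I_n)
    (l : literal tau) : bool :=
  if l.2 then w \in true_points A l.1 else w \notin true_points A l.1.

Definition realizes (tau : finType) (n : nat) (A : model tau n) (w : 'I_n)
    (pi : ptype tau) : bool :=
  [forall l in val pi, lit_sat A w l].

Definition num_points (tau : finType) (n : nat) (A : model tau n)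
    (pi : ptype tau) : nat :=
  #|[set w | realizes A w pi]|.

Inductive pform (tau : finType) : Type :=
| PLit (l : literal tau)
| PAnd (f g : pform tau)
| POr (f g : pform tau).

Inductive modality : Type :=
| DiaGe (k : nat)
| BoxLt (k : nat)
| DiaEq (k : nat)
| BoxNe (k : nat).

(* Atomic GMLU formulas are modalities applied to propositional formulas, so
   every literal occurs below some modality. *)
Inductive gmlu (tau : finType) : Type :=
| GBase (m : modality) (f : pform tau)
| GMod (m : modality) (f : gmlu tau)
| GAnd (f g : gmlu tau)
| GOr (f g : gmlu tau).

Fixpoint psat (tau : finType) (n : nat) (A : model tau n) (w : 'I_n)
    (f : pform tau) : bool :=
  match f with
  | PLit l => lit_sat A w l
  | PAnd f g => psat A w f && psat A w g
  | POr f g => psat A w f || psat A w g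
  end.

(* [X] is the set of points satisfying the formula under the modality. *)
Definition modality_sat (n : nat) (m : modality) (X : {set 'I_n}) : bool :=
  match m with
  | DiaGe k => k <= #|X|
  | BoxLt k => ~~ (k <= #|~: X|)
  | DiaEq k => #|X| == k
  | BoxNe k => ~~ (#|~: X| == k)
  end.

Fixpoint sat (tau : finType) (n : nat) (A : model tau n) (w : 'I_n)
    (f : gmlu tau) : bool :=
  match f with
  | GBase m f => modality_sat m [set v | psat A v f]
  | GMod m f => modality_sat m [set v | sat A v f]
  | GAnd f g => sat A w f && sat A w g
  | GOr f g => sat A w f || sat A w g
  end.

(* The truth value of a GMLU formula is the same at every point, so for 0 < n
   quantifying over all points agrees with evaluating at any one of them. *)
Definition models (tau : finType) (n : nat) (A : model tau n)
    (f : gmlu tau) : bool :=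
  [forall w, sat A w f].

Definition modality_depth (m : modality) : nat :=
  match m with
  | DiaGe k | BoxLt k => k
  | DiaEq k | BoxNe k => k.+1
  end.

Fixpoint gmlu_depth (tau : finType) (f : gmlu tau) : nat :=
  match f with
  | GBase m _ => modality_depth m
  | GMod m f => maxn (modality_depth m) (gmlu_depth f)
  | GAnd f g | GOr f g => maxn (gmlu_depth f) (gmlu_depth g)
  end.

Definition modality_size (m : modality) : nat :=
  match m with
  | DiaGe k | BoxLt k => k
  | DiaEq k | BoxNe k => k.+1
  end.

Fixpoint psize (tau : finType) (f : pform tau) : nat :=
  match f with
  | PLit _ => 1
  | PAnd f g | POr f g => psize f + psize g + 1
  end.

Fixpoint gmlu_size (tau : finType) (f : gmlu tau) : nat :=
  match f with
  | GBase m f => psize f + modality_size m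
  | GMod m f => gmlu_size f + modality_size m
  | GAnd f g | GOr f g => gmlu_size f + gmlu_size g + 1
  end.

Definition defines (tau : finType) (n : nat) (f : gmlu tau)
    (M : {set model tau n}) : Prop :=
  forall A : model tau n, models A f <-> A \in M.

Definition definable_in_size (tau : finType) (n d : nat)
    (M : {set model tau n}) (s : nat) : bool :=
  `[< exists f : gmlu tau,
        [/\ gmlu_depth f <= d, defines f M & gmlu_size f = s] >].

(* The minimum size of a GMLU_d formula defining [M]. The value 0 for undefinable
   [M] makes a positive lower bound on [complexity d M] imply definability. *)
Definition complexity (tau : finType) (n d : nat)
    (M : {set model tau n}) : nat :=
  match pselect (exists s, definable_in_size d M s) with
  | left ex => ex_minn ex
  | right _ => 0
  end.

Definition admissible (I : finType) (n d : nat) (nb : I -> nat) : Prop :=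
  [/\ forall i, nb i <= d,
      \sum_i nb i <= n
    & (exists i, nb i = d) \/ \sum_i nb i = n].

Definition type_class (tau I : finType) (n d : nat) (pi : I -> ptype tau)
    (nb : I -> nat) : {set model tau n} :=
  [set A : model tau n | [forall i,
     if nb i < d then num_points A (pi i) == nb i
     else d <= num_points A (pi i)]].

(* Main.v *)
Require Import Defs.
From HB Require Import structures.
From mathcomp Require Import all_boot.
From mathcomp Require Import boolp.
From mathcomp Require Import zify.

(** The lower bound counts the base subformulas of a defining formula, that is,
    its modalities applied to propositional formulas; call them atoms. The truth
    of a formula in a model is determined by the truth of its atoms, and the
    costs [modality_size] of the atoms add up to at most the size of the formula.
    An atom compares with a threshold the number of points whose type lies in a
    fixed set [T] of types ([counted_types]); for the box modalities [T] consists
    of the types refuting the propositional formula.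

    Let a model [A] belong to the class, and suppose that giving type [s] to a
    point of type [t] leads out of the class. Some atom then changes its truth
    value. So [T] contains exactly one of [s] and [t], and since the threshold is
    crossed when the count moves by one, at most [modality_size] points of [A] have
    their type in [T] ([atom_separates_retype]). Such an atom pays for every type
    in its set at once, and we call these types charged. Summing over the atoms,
    the points of charged types number at most the size of the formula
    ([sum_charged_leq]); it remains to see which types must be charged.

    If two types are saturated, that is, [nb] takes the value [d] there, then every
    type [s] occurring in the class is charged. Pick a saturated type [a] other than
    [s] and a model of the class having exactly [nb s] points of type [s], the points
    in excess having type [a]. Giving type [a] to a point of type [s] leads out of
    the class, and the separating atom cannot have [a] in its set: the at least
    [d] points of type [a] already put its count at or above every threshold
    that depth [d] allows, and one more point changes nothing
    ([charged_retype_saturated]). This yields the sum of all [nb s].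

    If at most one type is saturated, any exchange between two occurring types
    leads out of the class, so at most one occurring type is uncharged
    ([charged_retype]). The uncharged type has at most as many points as the most
    frequent type, hence the bound [n] minus that number of points.

    As [complexity] is [0] on undefinable classes, the class must also be shown
    definable: [class_gmlu] prescribes the number of points of each type. *)

Set Implicit Arguments.
Unset Strict Implicit.
Unset Printing Implicit Defensive.

(** * Types of points *)

(** A maximal consistent set decides every symbol: if it contained neither literal
    of [p], the negative one could be added to it. *)
Lemma ptype_neg (tau : finType) (s : ptype tau) (p : tau) :
  ((p, false) \in val s) = ((p, true) \notin val s).
Proof.
have /maxsetP [cons_s max_s] := valP s.
have [pT|pNT] := boolP ((p, true) \in val s).
  by have := forallP cons_s p; rewrite pT /=; case: (_ \in _).
have sub_s := subsetUr [set (p, false)] (val s).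
suff cons_s' : consistent ((p, false) |: val s).
  by rewrite -(max_s _ cons_s' sub_s) !inE eqxx.
apply/forallP => q; rewrite !inE !xpair_eqE andbF /= andbT.
have [->|_] := eqVneq q p; first by rewrite (negPf pNT).
exact: (forallP cons_s q).
Qed.

Lemma lit_set_max (tau : finType) (n : nat) (A : model tau n) (w : 'I_n) :
  maxset (@consistent tau) [set l | lit_sat A w l].
Proof.
apply/maxsetP; split=> [|S /forallP cons_S /subsetP sub_S].
  by apply/forallP => p; rewrite !inE /lit_sat /=; case: (_ \in _).
apply/setP => -[p b]; apply/idP/idP; last exact: sub_S.
move=> pbS; rewrite inE; apply/negPn/negP => nsat.
have nbS : (p, ~~ b) \in S.
  by apply: sub_S; rewrite inE; move: nsat; rewrite /lit_sat /=;
     case: {pbS} b => //=; rewrite negbK.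
by have := cons_S p; case: b {nsat} pbS nbS => /= -> ->.
Qed.

Definition point_type (tau : finType) (n : nat) (A : model tau n) (w : 'I_n) :
  ptype tau := Sub [set l | lit_sat A w l] (lit_set_max A w).

Lemma mem_point_type (tau : finType) (n : nat) (A : model tau n) (w : 'I_n) l :
  (l \in val (point_type A w)) = lit_sat A w l.
Proof. by rewrite SubK inE. Qed.

(** A type realized at a point is included in the consistent set of literals true
    there, hence equal to it by maximality. *)
Lemma realizesE (tau : finType) (n : nat) (A : model tau n) (w : 'I_n) s :
  realizes A w s = (point_type A w == s).
Proof.
apply/forall_inP/eqP => [sat_s|<- l]; last by rewrite mem_point_type.
have /maxsetP [_ max_s] := valP s; apply: val_inj; apply: max_s.
  by have /maxsetP [] := valP (point_type A w).
by apply/subsetP => l /sat_s; rewrite mem_point_type.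
Qed.

Definition model_of_types (tau : finType) (n : nat) (g : 'I_n -> ptype tau) :
  model tau n := [ffun p => [set w | (p, true) \in val (g w)]].

Lemma point_type_model_of (tau : finType) (n : nat) (g : 'I_n -> ptype tau) w :
  point_type (model_of_types g) w = g w.
Proof.
apply/val_inj/setP => -[p b]; rewrite mem_point_type /lit_sat /true_points.
by rewrite ffunE inE /=; case: b => //; rewrite ptype_neg.
Qed.

(** * Numbers of points *)

Definition weight (tau : finType) (n : nat) (A : model tau n)
    (T : {set ptype tau}) : nat := #|[set w | point_type A w \in T]|.

Lemma num_pointsE (tau : finType) (n : nat) (A : model tau n) s :
  num_points A s = #|[set w | point_type A w == s]|.
Proof. by apply: eq_card => w; rewrite !inE realizesE. Qed.

Lemma weightE (tau : finType) (n : nat) (A : model tau n) (T : {set ptype tau}) :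
  weight A T = \sum_(s in T) num_points A s.
Proof.
rewrite /weight -sum1_card (partition_big (point_type A) (mem T)) /=; last first.
  by move=> w; rewrite inE.
apply: eq_bigr => s sT; rewrite num_pointsE -sum1_card; apply: eq_bigl => w.
by rewrite !inE; case: eqP => [->|_]; rewrite ?andbF ?sT.
Qed.

Lemma weight1 (tau : finType) (n : nat) (A : model tau n) s :
  weight A [set s] = num_points A s.
Proof. by rewrite weightE big_set1. Qed.

Lemma weight_ge (tau : finType) (n : nat) (A : model tau n)
    (T : {set ptype tau}) s :
  s \in T -> num_points A s <= weight A T.
Proof. by move=> sT; rewrite weightE (bigD1 s) //= leq_addr. Qed.

Lemma sum_num_points (tau : finType) (n : nat) (A : model tau n) :
  \sum_s num_points A s = n.
Proof.
have := weightE A setT; rewrite (eq_bigl xpredT) => [<-|s]; last by rewrite inE.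
by rewrite /weight -[RHS]card_ord -cardsT; apply: eq_card => w; rewrite !inE.
Qed.

Lemma num_points_gt0 (tau : finType) (n : nat) (A : model tau n) s :
  0 < num_points A s -> exists w, point_type A w = s.
Proof.
by rewrite num_pointsE => /card_gt0P [w]; rewrite inE => /eqP <-; exists w.
Qed.

(** The function reads off the concatenation of [c i] copies of each [i]. *)
Lemma exists_fun_with_fibres (I : finType) (n : nat) (c : I -> nat) :
  \sum_i c i = n -> exists g : 'I_n -> I, forall i, #|[set w | g w == i]| = c i.
Proof.
move=> sum_c; pose s := flatten [seq nseq (c i) i | i <- enum I].
have size_s : size s = n.
  rewrite size_flatten /shape -map_comp sumnE big_map big_enum -sum_c.
  by apply: eq_bigr => i _ /=; rewrite size_nseq.
move/eqP: size_s => size_s; exists (tnth (Tuple size_s)) => i.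
have -> : c i = count_mem i (Tuple size_s).
  rewrite /= /s count_flatten -map_comp sumnE big_map big_enum (bigD1 i) //=.
  rewrite count_nseq /= eqxx mul1n big1 ?addn0 // => k ki.
  by rewrite count_nseq /= (negPf ki).
rewrite -sum1_count big_tuple -sum1_card.
by apply: eq_bigl => w; rewrite inE.
Qed.

Lemma exists_model_with_counts (tau : finType) (n : nat) (c : ptype tau -> nat) :
  \sum_s c s = n -> exists A : model tau n, forall s, num_points A s = c s.
Proof.
move=> /exists_fun_with_fibres [g card_g]; exists (model_of_types g) => s.
rewrite num_pointsE -card_g; apply: eq_card => w.
by rewrite !inE point_type_model_of.
Qed.

(** * Changing the type of one point *)

Definition retype (tau : finType) (n : nat) (A : model tau n) (w : 'I_n)
    (s : ptype tau) : model tau n :=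
  model_of_types (fun v => if v == w then s else point_type A v).

Lemma weight_retype (tau : finType) (n : nat) (A : model tau n) (w : 'I_n) s
    (T : {set ptype tau}) :
  weight (retype A w s) T + (point_type A w \in T) = weight A T + (s \in T).
Proof.
rewrite /weight (cardsD1 w) [X in _ = X + _](cardsD1 w) !inE.
rewrite point_type_model_of eqxx.
rewrite (_ : _ :\ w = [set v | point_type A v \in T] :\ w).
  by rewrite addnAC [RHS]addnAC; congr (_ + _); rewrite addnC.
by apply/setP => v; rewrite !inE point_type_model_of; case: eqP.
Qed.

Lemma num_points_retype (tau : finType) (n : nat) (A : model tau n) (w : 'I_n)
    s r :
  num_points (retype A w s) r + (point_type A w == r) = num_points A r + (s == r).
Proof. by have := weight_retype A w s [set r]; rewrite !inE !weight1. Qed.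

(** * Counting tests *)

Fixpoint pform_types (tau : finType) (f : pform tau) : {set ptype tau} :=
  match f with
  | PLit l => [set s : ptype tau | l \in val s]
  | PAnd f g => pform_types f :&: pform_types g
  | POr f g => pform_types f :|: pform_types g
  end.

Lemma psatE (tau : finType) (n : nat) (A : model tau n) (w : 'I_n) f :
  psat A w f = (point_type A w \in pform_types f).
Proof.
by elim: f => [l|f IHf g IHg|f IHf g IHg] /=; rewrite !inE ?mem_point_type ?IHf ?IHg.
Qed.

(** A box modality counts the points violating its argument; counting complementary
    types makes all four modalities tests on the size of one set. *)
Definition counted_types (tau : finType) (x : modality * pform tau) :
  {set ptype tau} :=
  match x.1 with
  | DiaGe _ | DiaEq _ => pform_types x.2
  | BoxLt _ | BoxNe _ => ~: pform_types x.2
  end.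

Definition count_test (m : modality) (c : nat) : bool :=
  match m with
  | DiaGe k => k <= c
  | BoxLt k => c < k
  | DiaEq k => c == k
  | BoxNe k => c != k
  end.

Definition atom_holds (tau : finType) (n : nat) (A : model tau n)
    (x : modality * pform tau) : bool :=
  modality_sat x.1 [set v | psat A v x.2].

Lemma atom_holdsE (tau : finType) (n : nat) (A : model tau n) x :
  atom_holds A x = count_test x.1 (weight A (counted_types x)).
Proof.
case: x => m f; rewrite /atom_holds /counted_types /weight /=.
have eqX : [set v | psat A v f] = [set w | point_type A w \in pform_types f].
  by apply/setP => v; rewrite !inE psatE.
have eqXC : ~: [set v | psat A v f] = [set w | point_type A w \in ~: pform_types f].
  by apply/setP => v; rewrite !inE psatE.
by case: m => k /=; rewrite ?eqXC ?eqX -?ltnNge.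
Qed.

(** A test tells [c] from [c.+1] only if its threshold lies between them, and the
    size of a modality is the largest such [c.+1]. *)
Lemma count_test_step (m : modality) (c : nat) :
  count_test m c != count_test m c.+1 -> c < modality_size m.
Proof. by case: m => k /=; lia. Qed.

(** Retyping [w] changes the count of [T] only when exactly one of the old and the
    new type is in [T], and then by one. The count becomes smaller if the old type
    is in [T] and larger if the new one is; this is why the bound is strict in the
    second case only. *)
Lemma atom_separates_retype (tau : finType) (n : nat) (A : model tau n)
    (w : 'I_n) s x :
  atom_holds A x != atom_holds (retype A w s) x ->
  let T := counted_types x in
  (point_type A w \in T) && (weight A T <= modality_size x.1) ||
  (s \in T) && (weight A T < modality_size x.1).
Proof.
rewrite !atom_holdsE /=; have := weight_retype A w s (counted_types x).
set c' := weight (retype _ _ _) _; set c := weight A _.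
case: (_ \in _) (s \in _) => -[]; rewrite /= ?addn0 ?addn1 => eq_c.
- by case: eq_c => ->; rewrite eqxx.
- by rewrite -eq_c eq_sym => /count_test_step ->.
- by rewrite eq_c => /count_test_step ->.
- by rewrite eq_c eqxx.
Qed.

(** * Atoms of a formula *)

Fixpoint atoms (tau : finType) (f : gmlu tau) : seq (modality * pform tau) :=
  match f with
  | GBase m f => [:: (m, f)]
  | GMod _ f => atoms f
  | GAnd f g | GOr f g => atoms f ++ atoms g
  end.

Lemma sum_modality_size_atoms (tau : finType) (f : gmlu tau) :
  \sum_(x <- atoms f) modality_size x.1 <= gmlu_size f.
Proof.
elim: f => [m f|m f IHf|f IHf g IHg|f IHf g IHg] /=;
  rewrite ?big_seq1 ?big_cat /=; lia.
Qed.

Lemma atoms_modality_size (tau : finType) (f : gmlu tau) :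
  all (fun x => modality_size x.1 <= gmlu_depth f) (atoms f).
Proof.
elim: f => [m f|m f IHf|f IHf g IHg|f IHf g IHg] /=; rewrite ?andbT ?all_cat.
- by case: m.
- by apply: sub_all IHf => x /leq_trans -> //; apply: leq_maxr.
- by apply/andP; split; [apply: sub_all IHf | apply: sub_all IHg];
    move=> x /leq_trans -> //; rewrite ?leq_maxl ?leq_maxr.
- by apply/andP; split; [apply: sub_all IHf | apply: sub_all IHg];
    move=> x /leq_trans -> //; rewrite ?leq_maxl ?leq_maxr.
Qed.

(** Both models have the same domain, so equal truth values of a subformula at every
    point give the same satisfying set, and an outer modality then gives equal
    truth values too. *)
Lemma sat_eq_atoms (tau : finType) (n : nat) (A B : model tau n) (f : gmlu tau) :
  all (fun x => atom_holds A x == atom_holds B x) (atoms f) ->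
  forall w, sat A w f = sat B w f.
Proof.
elim: f => [m f|m f IHf|f IHf g IHg|f IHf g IHg] /=; rewrite ?all_cat.
- by rewrite andbT => /eqP eqAB w.
- move=> /IHf eqAB _; congr modality_sat; apply/setP => v.
  by rewrite !inE eqAB.
- by move=> /andP [/IHf eqf /IHg eqg] w; rewrite eqf eqg.
- by move=> /andP [/IHf eqf /IHg eqg] w; rewrite eqf eqg.
Qed.

(** With [c] giving the number of points of each type, [s] is charged if some atom
    counts a set of types containing [s] and costs at least the number of
    points it counts. *)
Definition charged (tau : finType) (c : ptype tau -> nat) (f : gmlu tau)
    (s : ptype tau) : bool :=
  has (fun x => (s \in counted_types x) &&
         (\sum_(r in counted_types x) c r <= modality_size x.1)) (atoms f).

Lemma charged_mono (tau : finType) (c c' : ptype tau -> nat) (f : gmlu tau) s :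
  (forall r, c r <= c' r) -> charged c' f s -> charged c f s.
Proof.
move=> le_c; apply: sub_has => x /andP [-> /=]; apply: leq_trans.
exact: leq_sum.
Qed.

(** Only the sets with total at most their cost [k x] are used in the cover; the
    union of these has total at most the sum of their costs. *)
Lemma sum_covered_leq (X : Type) (I : finType) (c : I -> nat) (r : seq X)
    (T : X -> {set I}) (k : X -> nat) :
  \sum_(i | has (fun x => (i \in T x) && (\sum_(j in T x) c j <= k x)) r) c i
    <= \sum_(x <- r) k x.
Proof.
elim: r => [|x r IHr]; first by rewrite big_pred0.
rewrite big_cons /=; apply: leq_trans (leq_add (leqnn _) IHr).
pose P i := has (fun y => (i \in T y) && (\sum_(j in T y) c j <= k y)) r.
set le_k := (_ <= k x).
apply: leq_trans (_ : \sum_(i in T x | le_k) c i + \sum_(i | P i) c i <= _).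
  rewrite [\sum_(i in T x | _) _]big_mkcond /= [X in _ + X]big_mkcond /=.
  rewrite big_mkcond -big_split /=; apply: leq_sum => i _.
  by rewrite -/le_k -/(P i); case: (_ \in _) (P i) => -[]; case: le_k;
    rewrite /= ?leq_addr ?leq_addl.
rewrite leq_add2r; case: (boolP le_k) => [le_T|_].
  by under eq_bigl do rewrite andbT.
by rewrite big_pred0 // => i; rewrite andbF.
Qed.

Lemma sum_charged_leq (tau : finType) (c : ptype tau -> nat) (f : gmlu tau) :
  \sum_(s | charged c f s) c s <= gmlu_size f.
Proof. exact: leq_trans (sum_covered_leq _ _ _ _) (sum_modality_size_atoms f). Qed.

Lemma has_separating_atom (tau : finType) (n : nat) (f : gmlu tau)
    (M : {set model tau n}) (A B : model tau n) :
  defines f M -> A \in M -> B \notin M ->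
  has (fun x => atom_holds A x != atom_holds B x) (atoms f).
Proof.
move=> defM AM; apply: contraNT; rewrite -all_predC => same.
apply/defM/forallP => w; rewrite -(@sat_eq_atoms _ _ A).
  by move/defM: AM => /forallP.
by apply: sub_all same => x /=; rewrite negbK.
Qed.

Lemma charged_retype (tau : finType) (n : nat) (f : gmlu tau)
    (M : {set model tau n}) (A : model tau n) (w : 'I_n) s :
  defines f M -> A \in M -> retype A w s \notin M ->
  charged (num_points A) f (point_type A w) || charged (num_points A) f s.
Proof.
move=> defM AM /(has_separating_atom defM AM) sep.
rewrite /charged -has_predU; apply: sub_has sep => x /atom_separates_retype /=.
rewrite -weightE => /orP [->//|/andP [-> /ltnW ->]]; exact: orbT.
Qed.

Lemma has_predI_all (X : Type) (a b : pred X) (r : seq X) :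
  all a r -> has b r -> has (predI a b) r.
Proof.
elim: r => //= x r IHr /andP [ax a_r] /orP [bx|b_r]; first by rewrite ax bx.
by rewrite IHr ?orbT.
Qed.

(** The separating atom cannot contain the new type [s]: it would count at least
    [num_points A s], hence at least [d], points, whereas a count that
    one more point takes across a threshold of depth [d] is below [d]. *)
Lemma charged_retype_saturated (tau : finType) (n d : nat) (f : gmlu tau)
    (M : {set model tau n}) (A : model tau n) (w : 'I_n) s :
  gmlu_depth f <= d -> d <= num_points A s ->
  defines f M -> A \in M -> retype A w s \notin M ->
  charged (num_points A) f (point_type A w).
Proof.
move=> le_d d_le defM AM /(has_separating_atom defM AM) sep.
have sep' := has_predI_all (atoms_modality_size f) sep.
apply: sub_has sep' => x /= /andP [le_x /atom_separates_retype /=].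
rewrite -weightE => /orP [//|/andP [sT lt_w]].
have := leq_trans lt_w (leq_trans le_x le_d).
by rewrite ltnNge (leq_trans d_le) // weight_ge.
Qed.

(** * Definability *)

Definition pform_true (tau : finType) (p : tau) : pform tau :=
  POr (PLit (p, true)) (PLit (p, false)).

Definition ptype_pform (tau : finType) (p : tau) (s : ptype tau) : pform tau :=
  foldr (fun l => PAnd (PLit l)) (pform_true p) (enum (val s)).

Lemma psat_ptype_pform (tau : finType) (n : nat) (A : model tau n) w p s :
  psat A w (ptype_pform p s) = realizes A w s.
Proof.
rewrite /realizes /ptype_pform; transitivity (all (lit_sat A w) (enum (val s))).
  elim: (enum _) => [|l r /= -> //]; rewrite /= /lit_sat /=.
  by rewrite orbN.
apply/allP/forall_inP => sat_s l; have := sat_s l; by rewrite mem_enum.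
Qed.

Definition class_gmlu (tau I : finType) (d : nat) (pi : I -> ptype tau)
    (nb : I -> nat) (p : tau) : gmlu tau :=
  foldr (fun i => GAnd (GBase (if nb i < d then DiaEq (nb i) else DiaGe d)
                          (ptype_pform p (pi i))))
    (GBase (DiaGe 0) (pform_true p)) (enum I).

Lemma class_gmlu_depth (tau I : finType) (d : nat) (pi : I -> ptype tau) nb p :
  gmlu_depth (class_gmlu d pi nb p) <= d.
Proof.
rewrite /class_gmlu; elim: (enum I) => //= i r IHr; rewrite geq_max IHr andbT.
by case: ifP.
Qed.

Lemma class_gmlu_defines (tau I : finType) (n d : nat) (pi : I -> ptype tau)
    nb p :
  0 < n -> defines (class_gmlu d pi nb p) (type_class n d pi nb).
Proof.
move=> n_gt0 A; rewrite inE.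
pose P i := if nb i < d then num_points A (pi i) == nb i
            else d <= num_points A (pi i).
have satE w : sat A w (class_gmlu d pi nb p) = [forall i, P i].
  transitivity (all P (enum I)).
    rewrite /class_gmlu; elim: (enum I) => //= i r ->; congr (_ && _).
    have -> : [set v | psat A v (ptype_pform p (pi i))]
              = [set w | realizes A w (pi i)].
      by apply/setP => v; rewrite !inE psat_ptype_pform.
    by rewrite /P /num_points; case: ifP.
  apply/allP/forallP => allP i; last by [].
  by apply: allP; rewrite mem_enum.
by split=> [/forallP /(_ (Ordinal n_gt0))|P_A]; [|apply/forallP=> w]; rewrite satE.
Qed.

Lemma leq_complexity (tau : finType) (n d s : nat) (M : {set model tau n}) :
  (exists2 f : gmlu tau, gmlu_depth f <= d & defines f M) ->
  (forall f : gmlu tau, gmlu_depth f <= d -> defines f M -> s <= gmlu_size f) ->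
  s <= complexity d M.
Proof.
move=> [f f_d defM] lb; rewrite /complexity; case: pselect => [ex|[]].
  by case: ex_minnP => k /asboolP [g [g_d defg <-]] _; apply: lb.
by exists (gmlu_size f); apply/asboolP; exists f.
Qed.

(** * Models in a class and the lower bounds *)

Lemma unsaturated_of_neq (I : finType) (d : nat) (nb : I -> nat) i j :
  (forall i, nb i <= d) -> #|[set i | nb i == d]| < 2 ->
  i != j -> d <= nb i -> nb j < d.
Proof.
move=> nb_le one ij d_i; rewrite ltnNge; apply: contraL one => d_j.
rewrite -leqNgt; have <- : #|[set i; j]| = 2 by rewrite cards2 ij.
apply: subset_leq_card; apply/subsetP => u; rewrite !inE eqn_leq nb_le /=.
by case/orP => /eqP ->.
Qed.

Lemma num_points_class (tau I : finType) (n d : nat) (pi : I -> ptype tau) nb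
    (A : model tau n) i :
  A \in type_class n d pi nb -> nb i < d -> num_points A (pi i) = nb i.
Proof. by rewrite inE => /forallP /(_ i) + lt_d; rewrite lt_d => /eqP. Qed.

Lemma num_points_class_ge (tau I : finType) (n d : nat) (pi : I -> ptype tau) nb
    (A : model tau n) i :
  A \in type_class n d pi nb -> d <= nb i -> d <= num_points A (pi i).
Proof. by rewrite inE => /forallP /(_ i) + le_d; rewrite ltnNge le_d. Qed.

(** The points left over by [nb] all receive type [a]; this stays in the class when
    [a] is saturated or when no point is left over. *)
Lemma exists_model_in_class (tau : finType) (n d : nat) (nb : ptype tau -> nat) a :
  admissible n d nb -> nb a = d \/ \sum_s nb s = n ->
  exists2 A : model tau n, A \in type_class n d id nb &
    (forall s, nb s <= num_points A s) /\
    (forall s, s != a -> num_points A s = nb s).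
Proof.
move=> [nb_le_d sum_le _] a_d; set e := n - \sum_s nb s.
have [|A A_c] := @exists_model_with_counts tau n (fun s => nb s + (s == a) * e).
  have -> : \sum_s (nb s + (s == a) * e) = \sum_s nb s + e.
    rewrite big_split /=; congr (_ + _); rewrite (bigD1 a) //= eqxx mul1n.
    by rewrite big1 ?addn0 // => s /negPf ->.
  exact: subnKC.
exists A; last first.
  by split=> s; rewrite A_c ?leq_addr // => /negPf ->; rewrite addn0.
rewrite inE; apply/forallP => s; rewrite A_c.
have := nb_le_d s; have [->|_] := eqVneq s a; case: ifP; lia.
Qed.

Lemma retype_notin_class (tau : finType) (n d : nat) (nb : ptype tau -> nat)
    (A : model tau n) w s :
  A \in type_class n d id nb -> s != point_type A w ->
  num_points A (point_type A w) = nb (point_type A w) ->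
  nb (point_type A w) <= d ->
  retype A w s \notin type_class n d id nb.
Proof.
move=> AM neq num_t le_d; apply/negP => BM.
have := num_points_retype A w s (point_type A w); rewrite eqxx (negPf neq) num_t.
move: le_d; rewrite leq_eqVlt => /orP [/eqP eq_d|lt_d].
  by have := num_points_class_ge BM (eq_leq (esym eq_d)); rewrite eq_d /=; lia.
by rewrite (num_points_class BM lt_d); lia.
Qed.

Lemma retype_notin_class_target (tau : finType) (n d : nat)
    (nb : ptype tau -> nat) (A : model tau n) w s :
  A \in type_class n d id nb -> s != point_type A w -> nb s < d ->
  retype A w s \notin type_class n d id nb.
Proof.
move=> AM neq lt_d; apply/negP => BM.
have := num_points_retype A w s s; rewrite eqxx eq_sym (negPf neq).
by rewrite (num_points_class BM lt_d) (num_points_class AM lt_d); lia.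
Qed.

(** Each occurring type [s] is charged through its own model, in which the surplus
    points have a saturated type other than [s]; charges are compared by means
    of [nb], which is below the counts of all these models. *)
Lemma size_ge_two_saturated (tau : finType) (n d : nat) (nb : ptype tau -> nat)
    (f : gmlu tau) :
  admissible n d nb -> 2 <= #|[set s | nb s == d]| ->
  gmlu_depth f <= d -> defines f (type_class n d id nb) ->
  \sum_s nb s <= gmlu_size f.
Proof.
move=> adm two f_d defM; apply: leq_trans (sum_charged_leq nb f).
rewrite [leqRHS]big_mkcond /=; apply: leq_sum => s _.
have [nb_s0|nb_s_gt0] := posnP (nb s); first by rewrite nb_s0.
suff -> : charged nb f s by [].
have [a] : exists a, a \in [set s | nb s == d] :\ s.
  apply/card_gt0P; move: two; rewrite (cardsD1 s [set r | nb r == d]).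
  by case: (s \in _); rewrite ?add1n ?add0n // => /ltnW.
rewrite !inE => /andP [a_s /eqP nb_a].
have [A AM [le_A A_s]] := exists_model_in_class adm (or_introl nb_a).
have num_s : num_points A s = nb s by apply: A_s; rewrite eq_sym.
have [|w w_s] := @num_points_gt0 _ _ A s; first by rewrite num_s.
apply: (charged_mono le_A); rewrite -w_s.
apply: (charged_retype_saturated (s := a) f_d _ defM AM).
  by rewrite -nb_a le_A.
by apply: retype_notin_class; rewrite ?w_s //; have [] := adm.
Qed.

(** Two uncharged occurring types are impossible: one of them is unsaturated, and
    giving it to a point of the other type leads out of the class. The points of
    uncharged types therefore share a single type. *)
Lemma size_ge_one_saturated (tau : finType) (n d : nat) (nb : ptype tau -> nat)
    (f : gmlu tau) (A : model tau n) t :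
  (forall s, nb s <= d) -> #|[set s | nb s == d]| < 2 ->
  A \in type_class n d id nb ->
  (forall s, num_points A s <= num_points A t) ->
  defines f (type_class n d id nb) ->
  n - num_points A t <= gmlu_size f.
Proof.
move=> nb_le one AM max_t defM.
apply: leq_trans (sum_charged_leq (num_points A) f).
rewrite leq_subLR -{1}(sum_num_points A) (bigID (charged (num_points A) f)) /=.
rewrite addnC leq_add2r.
case: (pickP (fun s => ~~ charged (num_points A) f s && (0 < num_points A s)));
    last first.
  move=> none; rewrite big1 // => s ns.
  by have := none s; rewrite ns /=; lia.
move=> s /andP [ns s_gt0]; rewrite (bigD1 s) //= big1 ?addn0 ?max_t //.
move=> r /andP [nr rs]; apply/eqP; rewrite -leqn0 leqNgt; apply/negP => r_gt0.
have uncharged u v : v != u -> ~~ charged (num_points A) f u ->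
    ~~ charged (num_points A) f v -> 0 < num_points A u -> nb v < d -> False.
  move=> vu nu nv /num_points_gt0 [w w_u] v_d.
  have : retype A w v \notin type_class n d id nb.
    by apply: retype_notin_class_target; rewrite ?w_u.
  by move/(charged_retype defM AM); rewrite w_u (negPf nu) (negPf nv).
have [r_d|] := ltnP (nb r) d; first exact: (uncharged s r).
move/(unsaturated_of_neq nb_le one rs) => s_d.
by apply: (uncharged r s); rewrite 1?eq_sym.
Qed.

(** A saturated type has at least [d] points, so the most frequent type [j] also
    does and must be saturated; hence all types other than [j] are unsaturated. *)
Lemma num_points_class_unique (tau I : finType) (n d : nat)
    (pi : I -> ptype tau) nb (A : model tau n) j i :
  (forall i, nb i <= d) -> #|[set i | nb i == d]| < 2 ->
  A \in type_class n d pi nb ->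
  (forall i, num_points A (pi i) <= num_points A (pi j)) ->
  i != j -> num_points A (pi i) = nb i.
Proof.
move=> nb_le one AM max_j ij; apply: (num_points_class AM).
rewrite ltnNge; apply/negP => d_i.
have lt_j := unsaturated_of_neq nb_le one ij d_i.
have := leq_trans (num_points_class_ge AM d_i) (max_j i).
by rewrite (num_points_class AM lt_j) leqNgt lt_j.
Qed.

Theorem theorem3p6 (tau : finType) (n d : nat)
    (pi : 'I_(2 ^ #|tau|) -> ptype tau) (nb : 'I_(2 ^ #|tau|) -> nat)
    (tau_nonempty : 0 < #|tau|) (d_ge1 : 1 <= d) (d_le_n : d <= n)
    (pi_enum : bijective pi) (nb_adm : admissible n d nb) :
  (2 <= #|[set i | nb i == d]| ->
     \sum_i nb i <= complexity d (type_class n d pi nb)) /\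
  (~~ (2 <= #|[set i | nb i == d]|) ->
     forall j : 'I_(2 ^ #|tau|),
       (forall A : model tau n, A \in type_class n d pi nb ->
          forall i, num_points A (pi i) <= num_points A (pi j)) ->
       \sum_(i | i != j) nb i <= complexity d (type_class n d pi nb) /\
       (forall A : model tau n, A \in type_class n d pi nb ->
          \sum_(i | i != j) nb i = n - num_points A (pi j))).
Proof.
have /card_gt0P [p _] := tau_nonempty.
have n_gt0 : 0 < n by apply: leq_trans d_le_n.
have definable : exists2 f : gmlu tau,
    gmlu_depth f <= d & defines f (type_class n d pi nb).
  exists (class_gmlu d pi nb p); first exact: class_gmlu_depth.
  exact: class_gmlu_defines.
(* Counts indexed by the types themselves can be summed over sets of types. *)
have [h piK hK] := pi_enum; pose m s := nb (h s).
have sum_m : \sum_s m s = \sum_i nb i.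
  rewrite (reindex pi) /=; last exact: onW_bij.
  by apply: eq_bigr => i _; rewrite /m piK.
have classE : type_class n d pi nb = type_class n d id m.
  apply/setP => A; rewrite !inE; apply/forallP/forallP => H i.
    by have := H (h i); rewrite hK.
  by have := H (pi i); rewrite /m piK.
have card_m : #|[set s | m s == d]| = #|[set i | nb i == d]|.
  rewrite -(on_card_preimset (f := pi)); last exact: onW_bij.
  by apply: eq_card => i; rewrite !inE /m piK.
have [nb_le sum_le full] := nb_adm.
have m_adm : admissible n d m.
  split; [by move=> s; apply: nb_le|by rewrite sum_m|rewrite sum_m].
  by case: full => [[i nb_i]|]; [left; exists (pi i); rewrite /m piK|right].
split=> [two|]; last rewrite -ltnNge => one j max_j.
  apply: leq_complexity => // f f_d; rewrite classE -sum_m.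
  by apply: size_ge_two_saturated => //; rewrite card_m.
have count A : A \in type_class n d pi nb ->
    \sum_(i | i != j) nb i = n - num_points A (pi j).
  move=> AM; have := sum_num_points A.
  rewrite (reindex pi) /=; last exact: onW_bij.
  rewrite (bigD1 j) //= => sum_n; rewrite -[X in X - _]sum_n addKn.
  apply: eq_bigr => i ij.
  by rewrite (num_points_class_unique nb_le one AM (max_j A AM) ij).
split=> //; apply: leq_complexity => // f f_d defM.
have [a a_full] : exists a, m a = d \/ \sum_s m s = n.
  by case: m_adm => _ _ [[a a_d]|sum_n]; [exists a; left | exists (pi j); right].
have [A AM _] := exists_model_in_class m_adm a_full.
rewrite (count A) ?classE //.
apply: (@size_ge_one_saturated _ _ d m) => //; rewrite ?card_m -?classE //.
  by case: m_adm.
by move=> s; rewrite -(hK s); apply: max_j; rewrite classE.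
Qed.
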